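(* Let $n\ge 1$ and let $T:\mathbb{R}^{n+1}\to\mathbb{R}^{n+1}$ be the map $(x,y)\mapsto(\bar x,\bar y)$ given by $$\bar x=x^3-\mu x+\sum_{i=1}^n y_i,\qquad \bar y_1=bx,\qquad \bar y_{i+1}=a_i y_i\quad (i=1,\dots,n-1),$$ where $|b|<1$ and $|a_i|<a<1$ for $i=1,\dots,n-1$. Suppose $$|b|<\frac{(1-a)(3-\mu)}{3},\qquad 0<\mu<3.$$ Then $T$ has an attractor $A$ in the invariant domain $$D=\left\{(x,y):\ |x|<2\sqrt{\frac{\mu}{3}},\quad \|y\|<2\left(1-\frac{\mu}{3}\right)\sqrt{\frac{\mu}{3}}\right\}.$$
   Context: Here $x\in\mathbb{R}$, $y=(y_1,\dots,y_n)\in\mathbb{R}^n$, and $\|y\|=\sum_{i=1}^n|y_i|$. A domain $D$ is invariant if $T(D)\subset D$. That $T$ has an attractor $A$ in a domain $D$ is understood as follows: $T(D)\subset D$, and $A=\lim_{k\to\infty}T^kD=\bigcap_{k\ge0}T^k(D)$ is a nonempty set with $T(A)=A$.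
   Formalization: The bound a is assumed nonnegative; this is automatic for n ≥ 2, but for n = 1, where there are no a_i, a negative a makes the claim false (e.g. a = -1, μ = 2, b = 0.6, where D is not invariant). *)

(* Defs.v *)
From HB Require Import structures.
From mathcomp Require Import all_boot all_order all_algebra.
From mathcomp Require Import all_classical all_reals all_analysis.

Set Implicit Arguments.
Unset Strict Implicit.
Unset Printing Implicit Defensive.

Import Order.TTheory GRing.Theory Num.Theory.
Import numFieldNormedType.Exports.

Local Open Scope classical_set_scope.
Local Open Scope ring_scope.

Definition is_domain (X : topologicalType) (D : set X) : Prop :=
  [/\ D !=set0, open D & connected D].

Definition image_iter (X : Type) (T : X -> X) (D : set X) (k : nat) : set X :=
  iter k T @` D.

(* Convergence of a sequence of sets in the set-theoretic sense:
   liminf F = limsup F = A. *)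
Definition is_set_limit (X : Type) (F : nat -> set X) (A : set X) : Prop :=
  \bigcup_n \bigcap_(k >= n) F k = A /\ \bigcap_n \bigcup_(k >= n) F k = A.

Definition is_invariant_domain (X : topologicalType) (T : X -> X)
    (D : set X) : Prop :=
  is_domain D /\ T @` D `<=` D.

Definition is_attractor_in (X : topologicalType) (T : X -> X)
    (D A : set X) : Prop :=
  [/\ is_invariant_domain T D,
      is_set_limit (image_iter T D) A,
      A = \bigcap_k image_iter T D k,
      A !=set0
    & T @` A = A].

Definition l1norm (R : realType) (n : nat) (y : 'rV[R]_n) : R :=
  \sum_(i < n) `|y 0 i|.

(* The state space R^(n+1), n = m.+1 >= 1, is R * 'rV_m.+1.  With 0-based
   indices, the coordinate j = 0 of the image is b x, and the coordinate
   j = lift ord0 i, of value i.+1, is alpha i times the coordinate i of y. *)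
Definition delay_map (R : realType) (m : nat) (mu b : R) (alpha : 'I_m -> R)
    (p : R * 'rV[R]_m.+1) : R * 'rV[R]_m.+1 :=
  (p.1 ^+ 3 - mu * p.1 + \sum_(i < m.+1) p.2 0 i,
   \row_(j < m.+1)
     if unlift ord0 j is Some i
     then alpha i * p.2 0 (widen_ord (leqnSn m) i)
     else b * p.1).

Definition trapping_region (R : realType) (n : nat) (mu : R) :
    set (R * 'rV[R]_n) :=
  [set p | `|p.1| < 2 * Num.sqrt (mu / 3) /\
           l1norm p.2 < 2 * (1 - mu / 3) * Num.sqrt (mu / 3)].

(* Main.v *)
Require Import Defs.
From HB Require Import structures.
From mathcomp Require Import all_boot all_order all_algebra.
From mathcomp Require Import all_classical all_reals all_analysis.
From mathcomp Require Import ring lra.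
Import Order.TTheory GRing.Theory Num.Theory.
Import numFieldNormedType.Exports.
Local Open Scope classical_set_scope.
Local Open Scope ring_scope.

(** Write [s = sqrt (mu / 3)], so that [mu = 3 s^2] with [0 < s < 1], and let
    [c = 2 (1 - s^2) s].  The trapping region is the open box [|x| < 2 s],
    [||y|| < c].  On [|x| <= 2 s] the cubic [x^3 - 3 s^2 x] stays within
    [2 s^3] ([cubic_bound]), and [2 s^3 + c = 2 s], so the first coordinate of
    the image stays within [2 s], strictly as soon as [||y|| < c].  The second
    component of the image has norm at most [2 s |b| + a c], which is less than
    [c] precisely by the assumption on [b].

    The open box is therefore invariant, but the invariance of the attracting
    set, [T A = A], needs compactness: the map is not injective when [b] or
    some [alpha i] vanishes, and forward images do not commute with decreasing
    intersections in general.  The closed box [K] provides it.  It is also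
    invariant, and the contraction of the [y] part is strict on all of [K], so
    [T K] has [||y|| < c] and then [T (T K)] lies in the open box [D].  From
    [T (T K) <= D <= K] the intersections of the iterated images of [D] and of
    [K] coincide, and for the compact [K] the identity [T A = A] follows by
    applying the finite intersection property to the fibres of [T]
    ([image_bigcap_iter]).  This scheme is [attractor_of_absorbed_compact]. *)

(** * Nested compact sets *)

(** The members of the sequence form the basis of a proper filter; a cluster
    point of this filter belongs to the closure of each of them. *)
Lemma nested_compact_nonempty (X : topologicalType) (F : nat -> set X) :
  (forall i j, (i <= j)%N -> F j `<=` F i) ->
  (forall k, F k !=set0) -> (forall k, closed (F k)) -> compact (F 0%N) ->
  \bigcap_k F k !=set0.
Proof.
move=> Fmono Fne Fcl F0.
have FF : ProperFilter (filter_from setT F).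
  apply: filter_from_proper => //; apply: filter_fromT_filter; first by exists 0%N.
  by move=> i j; exists (maxn i j) => x Fx; split;
    apply: Fmono Fx; rewrite ?leq_maxl ?leq_maxr.
have [|q [_ clq]] := F0 _ FF; first by exists 0%N.
by exists q => k _; apply: Fcl => B; apply: clq; exists k.
Qed.

Lemma nonincreasing_set_limit (X : Type) (F : nat -> set X) :
  (forall i j, (i <= j)%N -> F j `<=` F i) -> is_set_limit F (\bigcap_k F k).
Proof.
move=> Fmono; split; apply/seteqP; split => x.
- move=> [n _ xn] k _; apply: (Fmono _ (maxn n k)); rewrite ?leq_maxr //.
  by apply: xn => /=; rewrite leq_maxl.
- by move=> xF; exists 0%N => // k _; exact: xF.
- by move=> xF n _; have [k nk] := xF n I; exact: Fmono.
- by move=> xF n _; exists n; [exact: leqnn | exact: xF].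
Qed.

(** * Iterated images *)

Lemma image_iter0 (X : Type) (T : X -> X) (D : set X) : image_iter T D 0 = D.
Proof. exact: image_id. Qed.

Lemma image_iterS (X : Type) (T : X -> X) (D : set X) k :
  image_iter T D k.+1 = T @` image_iter T D k.
Proof. by rewrite /image_iter image_comp. Qed.

Lemma image_iterD (X : Type) (T : X -> X) (D : set X) k l :
  image_iter T D (k + l) = image_iter T (image_iter T D l) k.
Proof.
rewrite /image_iter image_comp; congr (_ @` _).
by apply/funext => x /=; rewrite iterD.
Qed.

Lemma image_iter_subset (X : Type) (T : X -> X) (D E : set X) k :
  D `<=` E -> image_iter T D k `<=` image_iter T E k.
Proof. exact: image_subset. Qed.

Lemma image_iter_nonincreasing (X : Type) (T : X -> X) (D : set X) :
  T @` D `<=` D ->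
  forall i j, (i <= j)%N -> image_iter T D j `<=` image_iter T D i.
Proof.
move=> TD i j /subnK <-; elim: (j - i)%N => [|l IH]; first by rewrite add0n.
apply: subset_trans IH; rewrite addSn -addn1 image_iterD.
by apply: image_iter_subset; rewrite image_iterS image_iter0.
Qed.

Lemma image_iter_compact (X : topologicalType) (T : X -> X) (K : set X) k :
  continuous T -> compact K -> compact (image_iter T K k).
Proof.
move=> cT cK; elim: k => [|k IH]; first by rewrite image_iter0.
by rewrite image_iterS; apply: continuous_compact IH; exact: continuous_subspaceT.
Qed.

(** The inclusion from left to right is formal.  For the other one, a point [p]
    of the intersection has a preimage in every iterated image of [K], but this
    preimage may depend on the iterate; the traces of the fibre of [p] on the
    iterated images are nested nonempty compact sets, and any common point of
    them is a preimage of [p] in the intersection. *)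
Lemma image_bigcap_iter (X : topologicalType) (T : X -> X) (K : set X) :
  hausdorff_space X -> continuous T -> compact K -> T @` K `<=` K ->
  T @` (\bigcap_k image_iter T K k) = \bigcap_k image_iter T K k.
Proof.
move=> hX cT cK TK; have mono := image_iter_nonincreasing _ _ _ TK.
have cKk k : compact (image_iter T K k) by exact: image_iter_compact.
have clF p k : closed (image_iter T K k `&` T @^-1` [set p]).
  apply: closedI; first exact: (compact_closed hX (cKk k)).
  apply: preimage_closed => [x _|]; first exact: cT.
  exact: (compact_closed hX (@compact_set1 _ p)).
apply/seteqP; split => [_ [q qK <-] k _|p pK].
  apply: (mono k k.+1) => //; rewrite image_iterS.
  by exists q => //; exact: qK.
have [||||q qK] := @nested_compact_nonempty X
    (fun k => image_iter T K k `&` T @^-1` [set p]).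
- by move=> i j ij; apply: setSI; exact: mono.
- move=> k; have := pK k.+1 I; rewrite image_iterS => -[q qk Tq].
  by exists q.
- exact: clF.
- by apply: (subclosed_compact (clF p 0%N) (cKk 0%N)) => x [].
exists q; last by have [] := qK 0%N I.
by move=> k _; have [] := qK k I.
Qed.

(** When a compact set [K] surrounds [D] and enters it after finitely many
    steps, the iterated images of [D] and of [K] are interlaced, hence have the
    same intersection, and the compactness of [K] applies to it. *)
Lemma attractor_of_absorbed_compact (X : topologicalType) (T : X -> X)
    (D K : set X) (N : nat) :
  hausdorff_space X -> continuous T -> is_invariant_domain T D ->
  compact K -> T @` K `<=` K -> D `<=` K -> image_iter T K N `<=` D ->
  is_attractor_in T D (\bigcap_k image_iter T D k).
Proof.
move=> hX cT iD cK TK DK KD; have [[[d Dd] _ _] TD] := iD.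
have eDK : \bigcap_k image_iter T D k = \bigcap_k image_iter T K k.
  apply/seteqP; split => x xF k _; first exact: image_iter_subset (xF k I).
  by apply: image_iter_subset KD _ _; rewrite -image_iterD; exact: xF.
have mono := image_iter_nonincreasing _ _ _ TK.
split => //.
- by apply: nonincreasing_set_limit; exact: image_iter_nonincreasing.
- rewrite eDK; apply: nested_compact_nonempty => //.
  + by move=> k; exists (iter k T d); exists d => //; exact: DK.
  + by move=> k; apply: compact_closed => //; exact: image_iter_compact.
  + by rewrite image_iter0.
- by rewrite eDK; exact: image_bigcap_iter.
Qed.

(** * Topology of the state space *)

(** Such a set is a union of segments through the origin. *)
Lemma starshaped_connected (R : realType) (V : normedModType R) (D : set V) :
  (forall x t, D x -> 0 <= t <= 1 -> D (t *: x)) -> connected D.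
Proof.
move=> Dt.
have -> : D = \bigcup_(x in D) ((fun t : R => t *: x) @` `[0, 1]).
  apply/seteqP; split => [x Dx|_ [x Dx [t t01 <-]]].
    by exists x => //; exists 1; rewrite ?scale1r //= in_itv /= lexx ler01.
  by apply: Dt => //; move: t01; rewrite /= in_itv.
apply: bigcup_connected => [|x Dx].
  by exists 0 => x _; exists 0; rewrite ?scale0r //= in_itv /= lexx ler01.
apply: connected_continuous_connected; first exact: segment_connected.
apply: continuous_subspaceT => t; exact: scalel_continuous.
Qed.

Lemma continuous_rV (X T : topologicalType) n (f : X -> 'rV[T]_n) :
  (forall j, continuous (fun x => f x 0 j)) -> continuous f.
Proof.
move=> cf x A /= [P Pf PA].
suff : \near x, forall j, P 0 j (f x 0 j).
  apply: filterS => z Pz; apply: PA => i j; rewrite (ord1 i); exact: Pz.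
by apply: filter_forall => j; apply: cf; exact: Pf.
Qed.

Lemma l1norm_continuous (R : realType) n : continuous (@l1norm R n).
Proof.
apply: continuous_big => [|i _]; first exact: add_continuous.
move=> x; apply: (@continuous_comp _ _ _ (fun y : 'rV[R]_n => y 0 i) Num.norm).
  exact: coord_continuous.
exact: (@norm_continuous R R).
Qed.

Section box.
Variables (R : realType) (n : nat).
Local Notation state := (R * 'rV[R]_n)%type.

Let fst_norm_continuous : continuous (fun p : state => `|p.1|).
Proof. by move=> p; apply: cvg_norm; exact: cvg_fst. Qed.

Let snd_norm_continuous : continuous (fun p : state => l1norm p.2).
Proof.
by move=> p; apply: continuous_comp; [exact: cvg_snd | exact: l1norm_continuous].
Qed.

Lemma box_open (r c : R) : open [set p : state | `|p.1| < r /\ l1norm p.2 < c].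
Proof.
apply: openI; first by apply: open_comp (@open_lt R r) => p _.
by apply: open_comp (@open_lt R c) => p _.
Qed.

(** Each coordinate of [y] is bounded by [l1norm y], so the box is a closed
    subset of a product of segments. *)
Lemma box_compact (r c : R) :
  compact [set p : state | `|p.1| <= r /\ l1norm p.2 <= c].
Proof.
have cbox := compact_setX (@segment_compact R (- r) r)
  (@rV_compact R n (fun=> `[- c, c]%classic) (fun=> @segment_compact R (- c) c)).
apply: subclosed_compact cbox _.
  apply: closedI; first by apply: preimage_closed (@closed_le R r) => p _.
  by apply: preimage_closed (@closed_le R c) => p _.
move=> [x y] /= [xr yc]; split; rewrite /= ?in_itv -?ler_norml // => i.
rewrite in_itv -ler_norml; apply: le_trans yc.
by rewrite /l1norm (bigD1 i) //= lerDl sumr_ge0.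
Qed.

End box.

Lemma l1normZ (R : realType) n (t : R) (y : 'rV[R]_n) :
  l1norm (t *: y) = `|t| * l1norm y.
Proof. by rewrite /l1norm mulr_sumr; apply: eq_bigr => i _; rewrite mxE normrM. Qed.

Lemma l1norm_ge0 (R : realType) n (y : 'rV[R]_n) : 0 <= l1norm y.
Proof. exact: sumr_ge0. Qed.

Lemma box_connected (R : realType) n (r c : R) :
  connected [set p : R * 'rV[R]_n | `|p.1| < r /\ l1norm p.2 < c].
Proof.
apply: (@starshaped_connected R (R * 'rV[R]_n)%type) => -[x y] t /= [xr yc] /andP[t0 t1].
rewrite l1normZ normrM ger0_norm //; split.
  by apply: le_lt_trans xr; rewrite ler_piMl.
by apply: le_lt_trans yc; rewrite ler_piMl // l1norm_ge0.
Qed.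

(** * The delayed cubic map *)

Lemma delay_map_continuous (R : realType) m (mu b : R) (alpha : 'I_m -> R) :
  continuous (delay_map mu b alpha).
Proof.
have cx : continuous (fun p : R * 'rV[R]_m.+1 => p.1).
  by move=> p; exact: cvg_fst.
have cy j : continuous (fun p : R * 'rV[R]_m.+1 => p.2 0 j).
  move=> p; apply: (@continuous_comp _ _ _ snd (fun y : 'rV[R]_m.+1 => y 0 j)).
    exact: cvg_snd.
  exact: coord_continuous.
have cubic_cont :
    continuous (fun p : R * 'rV[R]_m.+1 => p.1 ^+ 3 - mu * p.1).
  move=> p; exact: (continuousB
    (continuous_comp (cx p) (@exprn_continuous R 3 p.1))
    (continuous_comp (cx p) (@mulrl_continuous R mu p.1))).
have sum_cont :
    continuous (fun p : R * 'rV[R]_m.+1 => \sum_(i < m.+1) p.2 0 i).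
  by apply: continuous_big => [|i _]; [exact: add_continuous | exact: cy].
have row_cont :
    continuous (fun p => (delay_map mu b alpha p).2 : 'rV[R]_m.+1).
  apply: continuous_rV => j.
  have -> : (fun p => (delay_map mu b alpha p).2 0 j) =
      fun p => if unlift ord0 j is Some i
        then alpha i * p.2 0 (widen_ord (leqnSn m) i) else b * p.1.
    by apply/funext => p; rewrite mxE.
  case: (unlift ord0 j) => [i|] p.
    exact: (continuous_comp (cy _ p) (@mulrl_continuous R (alpha i) _)).
  exact: (continuous_comp (cx p) (@mulrl_continuous R b _)).
move=> p.
exact: (cvg_pair (continuousD (cubic_cont p) (sum_cont p)) (row_cont p)).
Qed.

(** The extreme values [2 s^3] and [- 2 s^3] on the segment are reached both at
    an end point and at a critical point, whence the double roots below. *)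
Lemma cubic_bound (R : realType) (s x : R) :
  `|x| <= 2 * s -> `|x ^+ 3 - 3 * s ^+ 2 * x| <= 2 * s ^+ 3.
Proof.
rewrite !ler_norml => /andP[x1 x2]; apply/andP; split; rewrite -subr_ge0.
  have -> : x ^+ 3 - 3 * s ^+ 2 * x - - (2 * s ^+ 3) =
    (x - s) ^+ 2 * (x + 2 * s) by ring.
  by apply: mulr_ge0; [exact: sqr_ge0 | lra].
have -> : 2 * s ^+ 3 - (x ^+ 3 - 3 * s ^+ 2 * x) =
  (x + s) ^+ 2 * (2 * s - x) by ring.
by apply: mulr_ge0; [exact: sqr_ge0 | lra].
Qed.

Lemma delay_map_fst_bound (R : realType) m (s b : R) (alpha : 'I_m -> R) p :
  `|p.1| <= 2 * s ->
  `|(delay_map (3 * s ^+ 2) b alpha p).1| <= 2 * s ^+ 3 + l1norm p.2.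
Proof.
move=> px; apply: le_trans (ler_normD _ _) _; apply: lerD.
  exact: cubic_bound.
exact: ler_norm_sum.
Qed.

(** The last coordinate of [y] leaves the delay line and does not contribute to
    the image; its weight [a |y_m|] is dropped. *)
Lemma delay_map_snd_bound (R : realType) m (mu b a : R) (alpha : 'I_m -> R) p :
  0 <= a -> (forall i, `|alpha i| <= a) ->
  l1norm (delay_map mu b alpha p).2 <= `|b| * `|p.1| + a * l1norm p.2.
Proof.
move=> a0 alphaa; rewrite /l1norm big_ord_recl mxE unlift_none normrM lerD2l.
rewrite big_ord_recr /= mulrDr mulr_sumr.
apply: ler_wpDr; first exact: mulr_ge0.
apply: ler_sum => i _; rewrite mxE liftK normrM.
exact: ler_wpM2r.
Qed.

Theorem theorem3 (R : realType) (m : nat) (mu b a : R) (alpha : 'I_m -> R)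
  (hb1 : `|b| < 1)
  (ha0 : 0 <= a) (* automatic from halpha unless m = 0 *)
  (halpha : forall i : 'I_m, `|alpha i| < a)
  (ha1 : a < 1)
  (hb : `|b| < (1 - a) * (3 - mu) / 3)
  (hmu0 : 0 < mu) (hmu3 : mu < 3) :
  exists A : set (R * 'rV[R]_m.+1)%type,
    is_attractor_in (delay_map mu b alpha) (@trapping_region R m.+1 mu) A.
Proof.
set T := delay_map mu b alpha; set D := @trapping_region R m.+1 mu.
pose s := Num.sqrt (mu / 3); pose c := 2 * (1 - mu / 3) * s.
have s0 : 0 < s by rewrite sqrtr_gt0 divr_gt0.
have muE : mu = 3 * s ^+ 2 by rewrite sqr_sqrtr; [lra | apply: divr_ge0; lra].
have cE : c + 2 * s ^+ 3 = 2 * s by rewrite /c muE; field.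
have c0 : 0 < c by rewrite /c !mulr_gt0 // subr_gt0 ltr_pdivrMr; lra.
have bc : `|b| * (2 * s) + a * c < c.
  have : `|b| * (2 * s) < (1 - a) * (3 - mu) / 3 * (2 * s).
    by rewrite ltr_pM2r // mulr_gt0.
  by rewrite /c; lra.
pose K := [set p : R * 'rV[R]_m.+1 | `|p.1| <= 2 * s /\ l1norm p.2 <= c].
have TKx (p : R * 'rV[R]_m.+1) : `|p.1| <= 2 * s -> `|(T p).1| <= 2 * s ^+ 3 + l1norm p.2.
  by rewrite /T muE; exact: delay_map_fst_bound.
have TKy p : K p -> l1norm (T p).2 < c.
  move=> [px py]; apply: le_lt_trans bc.
  apply: le_trans (delay_map_snd_bound _ _ _ _ _ _ _ ha0 (fun i => ltW (halpha i))) _.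
  by apply: lerD; apply: ler_wpM2l.
have TK : T @` K `<=` K.
  move=> _ [p Kp <-]; split; last exact/ltW/TKy.
  by have [px py] := Kp; apply: le_trans (TKx _ px) _; lra.
exists (\bigcap_k image_iter T D k).
(* Two steps, because [x] becomes strictly bounded only after [y] has. *)
apply: (@attractor_of_absorbed_compact _ T D K 2).
- exact: (@norm_hausdorff R (R * 'rV[R]_m.+1)%type).
- exact: delay_map_continuous.
- split; last first.
    move=> _ [p [px py] <-]; split.
      by apply: le_lt_trans (TKx _ (ltW px)) _; rewrite -/s -/c in px py *; lra.
    by apply: TKy; split; exact: ltW.
  split; [|exact: box_open|exact: box_connected].
  exists 0; split; rewrite -/s /= ?normr0 ?mulr_gt0 //.
  by rewrite /l1norm big1 // => i _; rewrite mxE normr0.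
- exact: box_compact.
- exact: TK.
- by move=> p [px py]; split; exact: ltW.
- rewrite !image_iterS image_iter0 => _ [_ [p Kp <-] <-].
  have [qx qy] : K (T p) by apply: TK; exists p.
  split; last exact: TKy.
  by apply: le_lt_trans (TKx _ qx) _; have := TKy _ Kp; rewrite -/s; lra.
Qed.
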